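(* Let $K$ be a field and let $A=K[x_1,x_2,x_3;Q,\mathbb{A},\mathbb{B}]$ be a bi-quadratic algebra on 3 generators with $q_1\ne 1$, $q_2\ne 1$, $q_3=1$. 1. If $1-q_1q_2\ne 0$ then (up to $G_3$): $$x_2x_1=q_1x_1x_2,\quad x_3x_1=q_2x_1x_3,\quad x_3x_2=x_2x_3,$$ and so $A\simeq\mathbb{A}^3_{(q_1,q_2,1)}$. 2. If $1-q_1q_2=0$ then (up to $G_3$): $$x_2x_1=q_1x_1x_2,\quad x_3x_1=q_1^{-1}x_1x_3,\quad x_3x_2=x_2x_3+\lambda x_1+b_3$$ where $\lambda,b_3\in\{0,1\}$. The algebra $A=K[x_1][x_3,x_2;\sigma,\sigma^{-1},\rho=1,b=\lambda x_1+b_3]$ is a diskew polynomial algebra where $\sigma(x_1)=q_1^{-1}x_1$. The algebra $A=K[x_1,h][x_3,x_2;\sigma,a=h]$ is a classical generalized Weyl algebra where $\sigma(x_1)=q_1^{-1}x_1$ and $\sigma(h)=h+b$. If $b_3=0$ then the element $C=h+\alpha'$, where $\alpha'=\lambda(1-q_1^{-1})^{-1}x_1$, is a central element of the algebra $A$ and $A=K[x_1,C][x_3,x_2;\sigma,a=C-\alpha']$ is a classical generalized Weyl algebra where $\sigma(x_1)=q_1^{-1}x_1$ and $\sigma(C)=C$.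
   Context: Let $K$ be a field, $K^\times=K\setminus\{0\}$. A bi-quadratic algebra on 3 generators $A=K[x_1,x_2,x_3;Q,\mathbb{A},\mathbb{B}]$ is the $K$-algebra generated by $x_1,x_2,x_3$ subject to the defining relations $x_2x_1-q_1x_1x_2=ax_1+bx_2+cx_3+b_1$, $x_3x_1-q_2x_1x_3=\alpha x_1+\beta x_2+\gamma x_3+b_2$, $x_3x_2-q_3x_2x_3=\lambda x_1+\mu x_2+\nu x_3+b_3$, where $Q=(q_1,q_2,q_3)\in (K^\times)^3$, $\mathbb{A}=\begin{pmatrix}a&b&c\\ \alpha&\beta&\gamma\\ \lambda&\mu&\nu\end{pmatrix}$ has entries in $K$, $\mathbb{B}=(b_1,b_2,b_3)\in K^3$; it is always assumed that the monomials $x_1^ix_2^jx_3^k$ ($i,j,k\ge0$) form a $K$-basis of $A$ (PBW basis). The quantum space $\mathbb{A}^3_{(q_1,q_2,q_3)}$ is the algebra of this form with $\mathbb{A}=0$ and $\mathbb{B}=0$. $G_3$ is the group of affine changes of generators $x_i\mapsto\lambda_ix_i+\mu_i$ ($\lambda_i\in K^\times$, $\mu_i\in K$, $i=1,2,3$). ''Up to $G_3$'' means: after such a change of the canonical generators, the new canonical generators (again denoted $x_1,x_2,x_3$) have the displayed defining relations (with new parameters denoted by the same letters). Diskew polynomial ring: for a ring $D$, ring endomorphisms $\sigma,\tau$ of $D$ and $\rho,b\in D$ with $\sigma\tau(d)\rho=\rho\tau\sigma(d)$ and $\sigma\tau(d)b=bd$ for all $d\in D$, the ring $D[x,y;\sigma,\tau,b,\rho]$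 is generated by $D,x,y$ subject to $xd=\sigma(d)x$, $yd=\tau(d)y$ ($d\in D$), $xy-\rho yx=b$. Classical generalized Weyl algebra: for a ring $D$, an automorphism $\sigma$ of $D$ and a central element $a\in D$, the ring $D[x,y;\sigma,a]$ is generated by $D,x,y$ subject to $xd=\sigma(d)x$, $yd=\sigma^{-1}(d)y$ ($d\in D$), $yx=a$, $xy=\sigma(a)$. In the present theorem the roles of $x,y$ are played by $x_3,x_2$, so $h=x_2x_3$. *)

(* Defs.v *)
From HB Require Import structures.
From mathcomp Require Import all_boot all_algebra.

Set Implicit Arguments.
Unset Strict Implicit.
Unset Printing Implicit Defensive.

Import GRing.Theory.
Local Open Scope ring_scope.

(* Generators x_1, x_2, x_3 are x 0, x 1, x 2 for x : 'I_3 -> A; likewise all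
   row, column and parameter indices are shifted down by one. *)

Definition row3 (K : fieldType) (a b c : K) : 'rV[K]_3 :=
  \row_(j < 3) [:: a; b; c]`_j.

(* The rows of M, Q and B are attached, in order, to the pairs
   (x_2, x_1), (x_3, x_1), (x_3, x_2). *)
Definition biquadratic_relations (K : fieldType)
    (Q : 'rV[K]_3) (M : 'M[K]_3) (B : 'rV[K]_3)
    (E : algType K) (x : 'I_3 -> E) : Prop :=
  let rhs (i : 'I_3) : E :=
    M i 0 *: x 0 + M i 1 *: x 1 + M i 2 *: x 2 + (B 0 i)%:A in
  [/\ x 1 * x 0 - Q 0 0 *: (x 0 * x 1) = rhs 0,
      x 2 * x 0 - Q 0 1 *: (x 0 * x 2) = rhs 1
    & x 2 * x 1 - Q 0 2 *: (x 1 * x 2) = rhs 2].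

(* "A is the K-algebra generated by x subject to the relations rel".  The test
   algebras E are nonzero (algType), which loses nothing: the zero algebra
   receives exactly one morphism from any algebra. *)
Definition algebra_presented_by (K : fieldType) (A : algType K) (n : nat)
    (rel : forall E : algType K, ('I_n -> E) -> Prop) (x : 'I_n -> A) : Prop :=
  rel A x /\
  forall (E : algType K) (y : 'I_n -> E), rel E y ->
    exists f : {lrmorphism A -> E},
      (forall i, f (x i) = y i) /\
      forall g : {lrmorphism A -> E}, (forall i, g (x i) = y i) -> g =1 f.

Definition is_basis (K : fieldType) (V : lmodType K) (I : eqType) (e : I -> V)
    : Prop :=
  (forall v : V, exists (s : seq I) (c : I -> K), v = \sum_(i <- s) c i *: e i)
  /\
  (forall (s : seq I) (c : I -> K), uniq s ->
     \sum_(i <- s) c i *: e i = 0 -> forall i, i \in s -> c i = 0).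

Definition pbw_monomial (K : fieldType) (A : algType K) (x : 'I_3 -> A)
    (m : nat * nat * nat) : A :=
  x 0 ^+ m.1.1 * x 1 ^+ m.1.2 * x 2 ^+ m.2.

(* A = K[x_1, x_2, x_3; Q, M, B] *)
Definition biquadratic_algebra (K : fieldType)
    (Q : 'rV[K]_3) (M : 'M[K]_3) (B : 'rV[K]_3)
    (A : algType K) (x : 'I_3 -> A) : Prop :=
  [/\ forall i, Q 0 i != 0,
      algebra_presented_by (@biquadratic_relations K Q M B) x
    & is_basis (pbw_monomial x)].

Definition quantum_space (K : fieldType) (Q : 'rV[K]_3)
    (A : algType K) (x : 'I_3 -> A) : Prop :=
  biquadratic_algebra Q 0 0 x.

(* x' is obtained from x by an element of G_3. *)
Definition G3_change (K : fieldType) (A : algType K) (x x' : 'I_3 -> A)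
    : Prop :=
  exists l m : 'I_3 -> K,
    (forall i, l i != 0) /\ forall i, x' i = l i *: x i + (m i)%:A.

Definition algebra_isomorphic (K : fieldType) (A E : algType K) : Prop :=
  exists f : {lrmorphism A -> E}, bijective f.

(* "R is the ring generated by D, x, y subject to the relations rel", where D
   (with its own multiplication table) is mapped to R by iota. *)
Definition ring_presented_over (D R : pzRingType)
    (rel : forall S : pzRingType, (D -> S) -> S -> S -> Prop)
    (iota : {rmorphism D -> R}) (x y : R) : Prop :=
  rel R iota x y /\
  forall (S : pzRingType) (f : {rmorphism D -> S}) (u v : S), rel S f u v ->
    exists g : {rmorphism R -> S},
      [/\ forall d, g (iota d) = f d, g x = u & g y = v] /\
      forall g' : {rmorphism R -> S},
        [/\ forall d, g' (iota d) = f d, g' x = u & g' y = v] -> g' =1 g.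

(* R = D[x, y; sigma, tau, b, rho] *)
Definition diskew_polynomial_ring (D R : pzRingType)
    (iota : {rmorphism D -> R}) (x y : R)
    (sigma tau : {rmorphism D -> D}) (b rho : D) : Prop :=
  [/\ forall d, sigma (tau d) * rho = rho * tau (sigma d),
      forall d, sigma (tau d) * b = b * d
    & ring_presented_over
        (fun (S : pzRingType) (f : D -> S) (u v : S) =>
           [/\ forall d, u * f d = f (sigma d) * u,
               forall d, v * f d = f (tau d) * v
             & u * v - f rho * v * u = f b])
        iota x y].

(* R = D[x, y; sigma, a], where sigma' is the inverse of sigma *)
Definition classical_GWA (D R : pzRingType)
    (iota : {rmorphism D -> R}) (x y : R)
    (sigma sigma' : {rmorphism D -> D}) (a : D) : Prop :=
  [/\ cancel sigma sigma', cancel sigma' sigma,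
      forall d, GRing.comm a d
    & ring_presented_over
        (fun (S : pzRingType) (f : D -> S) (u v : S) =>
           [/\ forall d, u * f d = f (sigma d) * u,
               forall d, v * f d = f (sigma' d) * v,
               v * u = f a
             & u * v = f (sigma a)])
        iota x y].

(* Main.v *)
(* Any substitution x_i |-> l_i x_i + m_i acts on ordered monomials one variable
   at a time, so it preserves the PBW property: evaluating a commutative
   polynomial on ordered monomials turns it into an automorphism of
   K[X_1, X_2, X_3].  Since q_1, q_2 <> 1, a translation kills a, b and alpha.
   Comparing the two reductions of x_3 x_2 x_1 on the PBW basis then forces all
   parameters but lambda and b_3 to vanish, and (1 - q_1 q_2) lambda =
   (1 - q_1 q_2) b_3 = 0; if q_1 q_2 = 1, rescaling brings these two into {0, 1}.

   The ring presentations test A against rings that are not K-algebras; given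
   K -> S, the K-algebra to map into is the centralizer of K in S * A.  Both
   generalized Weyl algebras are instances of one presentation over
   K[x_1, h + kappa x_1], for kappa = 0 and kappa = lambda / (1 - q_1^-1). *)

Require Import Defs.
From HB Require Import structures.
From mathcomp Require Import all_boot all_order all_algebra.
From mathcomp Require Import mpoly boolp ring.

Set Implicit Arguments.
Unset Strict Implicit.
Unset Printing Implicit Defensive.

Import GRing.Theory.
Local Open Scope ring_scope.

Lemma ord2_cases (i : 'I_2) : i = 0 \/ i = 1.
Proof. by case: i => -[|[|//]] lt_i; [left|right]; apply: val_inj. Qed.

Lemma ord3_cases (i : 'I_3) : [\/ i = 0, i = 1 | i = 2].
Proof.
case: i => -[|[|[|//]]] lt_i; [apply: Or31|apply: Or32|apply: Or33];
  exact: val_inj.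
Qed.

Lemma row3E (K : fieldType) (a b c : K) :
  (row3 a b c 0 0 = a) * (row3 a b c 0 1 = b) * (row3 a b c 0 2 = c).
Proof. by rewrite /row3 !mxE. Qed.

(** * Morphisms out of polynomial rings *)

(** With [f' = f \o sigma] this is skew commutation of [u] with the image of [f]; with [u = 1] it is
    uniqueness of morphisms. One induction serves both. *)
Lemma intertwine_poly (K : fieldType) (S : pzRingType)
    (f f' : {rmorphism {poly K} -> S}) (u : S) :
    (forall c, u * f c%:P = f' c%:P * u) -> u * f 'X = f' 'X * u ->
  forall p, u * f p = f' p * u.
Proof.
move=> ufC ufX; elim/poly_ind => [|p c ufp]; first by rewrite !rmorph0 mulr0 mul0r.
by rewrite !rmorphD !rmorphM mulrDr mulrDl ufC mulrA ufp -!mulrA ufX.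
Qed.

Lemma intertwine_mpoly (K : fieldType) n (S : pzRingType)
    (f f' : {rmorphism {mpoly K[n]} -> S}) (u : S) :
    (forall c, u * f c%:MP = f' c%:MP * u) ->
    (forall i, u * f 'X_i = f' 'X_i * u) ->
  forall p, u * f p = f' p * u.
Proof.
move=> ufC ufX; pose P p := u * f p = f' p * u.
have P_mul p q : P p -> P q -> P (p * q).
  by rewrite /P => Pp Pq; rewrite !rmorphM mulrA Pp -!mulrA Pq.
have P_1 : P 1 by rewrite /P !rmorph1 mulr1 mul1r.
move=> p; rewrite -/(P p) [p]mpolyE; apply: (big_ind P) => [|p1 p2 P1 P2|m _].
- by rewrite /P !rmorph0 mulr0 mul0r.
- by rewrite /P !rmorphD mulrDr mulrDl P1 P2.
rewrite -mul_mpolyC; apply: (P_mul) => //.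
rewrite mpolyXE_id; apply: (big_ind P P_1 P_mul) => i _.
by elim: (m i) => [|k Pk]; rewrite ?expr0 // exprS; apply: (P_mul) => //; apply: ufX.
Qed.

Lemma mpoly_rmorphism_ext (K : fieldType) (n : nat) (S : pzRingType)
    (f g : {rmorphism {mpoly K[n]} -> S}) :
  (forall c, f c%:MP = g c%:MP) -> (forall i, f 'X_i = g 'X_i) -> f =1 g.
Proof.
move=> fgC fgX p; rewrite -[LHS]mul1r -[RHS]mulr1.
by apply: (intertwine_mpoly (f := f) (f' := g)) => [c|i]; rewrite mul1r mulr1.
Qed.

(** * Evaluation on ordered monomials and PBW bases *)

Section OrderedEvaluation.
Variables (K : fieldType) (A : algType K) (n : nat).
Implicit Types (x : 'I_n -> A) (p : {mpoly K[n]}).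

(* [A] need not be commutative: [mmap] multiplies the powers of the [x i] in
   the order of increasing [i], so this is linear but not multiplicative. *)
Definition ordered_eval x p : A := mmap (in_alg A) x p.

Fact ordered_eval_linear x : linear (ordered_eval x).
Proof.
by move=> c p q; rewrite /ordered_eval mmapD mmapZ /= mulr_algl.
Qed.

HB.instance Definition _ x :=
  GRing.isLinear.Build K {mpoly K[n]} A _ (ordered_eval x) (ordered_eval_linear x).

Lemma ordered_evalX x m : ordered_eval x 'X_[m] = \prod_(i < n) x i ^+ m i.
Proof. exact: mmapX. Qed.

Lemma linear_mpoly_ext (V : lmodType K) (f g : {linear {mpoly K[n]} -> V}) :
  (forall m, f 'X_[m] = g 'X_[m]) -> f =1 g.
Proof.
move=> fg p; rewrite [p]mpolyE !linear_sum; apply: eq_bigr => m _.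
by rewrite !linearZ /= fg.
Qed.

Lemma horner_alg_widen (C : algType K) (y : C) (p : {poly K}) N :
  (size p <= N)%N -> horner_alg y p = \sum_(k < N) p`_k *: y ^+ k.
Proof.
move=> le_pN; rewrite /horner_alg /horner_morph (@horner_coef_wide _ N).
  by apply: eq_bigr => k _; rewrite coef_map /= mulr_algl.
exact: leq_trans (size_poly _ _) le_pN.
Qed.

(** Multiplicativity survives for univariate factors taken in the order of the variables: both sides
    expand over the same exponent functions. Padding all factors to the length [N] makes these
    functions a finite type. *)
Lemma ordered_eval_prod x (p : 'I_n -> {poly K}) :
  ordered_eval x (\prod_(i < n) horner_alg 'X_i (p i)) =
  \prod_(i < n) horner_alg (x i) (p i).
Proof.
pose N := (\max_(i < n) size (p i))%N.
have le_N i : (size (p i) <= N)%N by apply: (leq_bigmax i).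
have expand (C : algType K) (y : 'I_n -> C) : \prod_(i < n) horner_alg (y i) (p i) =
    \sum_(k : {ffun 'I_n -> 'I_N})
       (\prod_(i < n) (p i)`_(k i)) *: \prod_(i < n) y i ^+ k i.
  under eq_bigr => i _ do rewrite (horner_alg_widen (y i) (le_N i)).
  rewrite bigA_distr_bigA; apply: eq_bigr => k _.
  elim/big_rec3: _ => [|i z c u _ ->]; first by rewrite scale1r.
  by rewrite /= -scalerAl -scalerAr scalerA.
rewrite !expand linear_sum; apply: eq_bigr => k _; rewrite linearZ /=.
have -> : \prod_(i < n) 'X_i ^+ k i = 'X_[[multinom val (k i) | i < n]] :> {mpoly K[n]}.
  by rewrite [RHS]mpolyXE_id; apply: eq_bigr => i _; rewrite mnmE.
by rewrite ordered_evalX; congr (_ *: _); apply: eq_bigr => i _; rewrite mnmE.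
Qed.

Definition affine_tuple (l m : 'I_n -> K) : n.-tuple {mpoly K[n]} :=
  [tuple l i *: 'X_i + (m i)%:MP | i < n].

(** By linearity a monomial suffices, and an affine substitution turns a monomial into an ordered
    product of univariate polynomials. *)
Lemma ordered_eval_affine x l m p :
  ordered_eval (fun i => l i *: x i + (m i)%:A) p =
  ordered_eval x (comp_mpoly (affine_tuple l m) p).
Proof.
pose f := (ordered_eval x \o comp_mpoly (affine_tuple l m) : {linear _ -> A}).
rewrite -[RHS]/(f p); apply: linear_mpoly_ext => /= k.
(* Stated in any algebra, since it is applied both to [x i] in [A] and to ['X_i]. *)
have affine (C : algType K) (y : C) i j :
    (l i *: y + (m i)%:A) ^+ j = horner_alg y ((l i *: 'X + (m i)%:P) ^+ j).
  rewrite rmorphXn rmorphD /= horner_algC -mul_polyC rmorphM /=.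
  by rewrite horner_algC horner_algX mulr_algl.
rewrite ordered_evalX comp_mpolyX.
under eq_bigr do rewrite affine.
rewrite -ordered_eval_prod; congr ordered_eval.
by apply: eq_bigr => i _; rewrite -affine tnth_mktuple alg_mpolyC.
Qed.

Lemma comp_affineK l m : (forall i, l i != 0) ->
  cancel (comp_mpoly (affine_tuple l m))
    (comp_mpoly (affine_tuple (fun i => (l i)^-1) (fun i => - (m i / l i)))).
Proof.
move=> l_neq0; set f := comp_mpoly _; set g := comp_mpoly _.
apply: (@mpoly_rmorphism_ext _ _ _ (g \o f) idfun) => [c|i] /=.
  by rewrite /f /g !comp_mpolyC.
rewrite /f comp_mpolyXU -tnth_nth tnth_mktuple raddfD /= /g comp_mpolyC comp_mpolyZ.
rewrite comp_mpolyXU -tnth_nth tnth_mktuple scalerDr scalerA divff // scale1r.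
by rewrite -mul_mpolyC -mpolyCM mulrN mulrCA divff // mulr1 mpolyCN subrK.
Qed.

End OrderedEvaluation.

(** * Evaluation morphisms out of commutative polynomial rings *)

Lemma lrmorphism_of_linear (K : fieldType) (A B : algType K)
    (f : {linear A -> B}) :
  monoid_morphism f -> exists g : {lrmorphism A -> B}, g =1 f.
Proof.
move=> f_mul.
pose mix := GRing.isMonoidMorphism.Build A B f f_mul.
by exists (HB.pack_for {lrmorphism A -> B} (f : A -> B) f mix).
Qed.

Lemma poly_eval_lrmorphism (K : fieldType) (A : algType K) (y : A) :
  exists iota : {lrmorphism {poly K} -> A}, iota 'X = y.
Proof.
have eval_linear : linear (horner_alg y).
  by move=> c p q; rewrite rmorphD -mul_polyC rmorphM /= horner_algC mulr_algl.
pose mix := GRing.isLinear.Build K {poly K} A _ (horner_alg y) eval_linear.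
have [|f fE] := @lrmorphism_of_linear _ _ _
  (HB.pack_for {linear {poly K} -> A} (horner_alg y : {poly K} -> A) mix).
  by split=> [|p q]; [apply: rmorph1|apply: rmorphM].
by exists f; rewrite fE /= horner_algX.
Qed.

(** Commuting values make [ordered_eval] multiplicative: in a product of two monomials each power of
    [y i] moves past the powers of the other values. *)
Lemma mpoly_eval_lrmorphism (K : fieldType) (A : algType K) n (y : 'I_n -> A) :
  (forall i j, GRing.comm (y i) (y j)) ->
  exists iota : {lrmorphism {mpoly K[n]} -> A}, forall i, iota 'X_i = y i.
Proof.
move=> y_comm; have eval_mulX m k : ordered_eval y ('X_[m] * 'X_[k]) =
    ordered_eval y 'X_[m] * ordered_eval y 'X_[k].
  rewrite -mpolyXD !ordered_evalX; elim: (index_enum _) => [|i r IHr].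
    by rewrite !big_nil mulr1.
  rewrite !big_cons IHr mnmDE exprD -!mulrA; congr (_ * _); rewrite !mulrA.
  congr (_ * _); apply: (big_ind (GRing.comm (y i ^+ k i))) => [|a b|j _].
  - exact: commr1.
  - exact: commrM.
  - by apply/commrX/commr_sym/commrX.
have [|f fE] := @lrmorphism_of_linear _ _ _ (ordered_eval y).
  split=> [|p q]; first by rewrite -mpolyC1 [LHS]mmapC; apply: scale1r.
  rewrite [p]mpolyE mulr_suml !linear_sum /= mulr_suml; apply: eq_bigr => m _.
  rewrite -scalerAl !linearZ /= -scalerAl; congr (_ *: _).
  rewrite [q]mpolyE mulr_sumr !linear_sum /= mulr_sumr; apply: eq_bigr => k _.
  by rewrite -scalerAr !linearZ /= -scalerAr eval_mulX.
by exists f => i; rewrite fE /= /ordered_eval mmapX mmap1U.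
Qed.

Section PBW.
Variables (K : fieldType) (A : algType K).
Implicit Types (x : 'I_3 -> A) (p : {mpoly K[3]}) (t : nat * nat * nat).

Definition exponents (m : 'X_{1..3}) : nat * nat * nat := (m 0, m 1, m 2).
Definition multinom_of t : 'X_{1..3} := [multinom [tuple t.1.1; t.1.2; t.2]].

Lemma multinom_ofK : cancel multinom_of exponents.
Proof. by case=> -[i j] k. Qed.

Lemma exponentsK : cancel exponents multinom_of.
Proof.
move=> m; apply/mnmP => i.
by rewrite multinomE (tnth_nth 0%N); case: (ord3_cases i) => ->.
Qed.

Lemma ordered_eval_pbw x t : ordered_eval x 'X_[multinom_of t] = pbw_monomial x t.
Proof.
rewrite ordered_evalX /pbw_monomial !big_ord_recr big_ord0 /= mul1r.
by congr (_ ^+ _ * _ ^+ _ * _ ^+ _); [congr x|congr x|congr x]; apply: val_inj.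
Qed.

Lemma ordered_evalE x p :
  ordered_eval x p = \sum_(m <- msupp p) p@_m *: pbw_monomial x (exponents m).
Proof.
rewrite {1}[p]mpolyE linear_sum; apply: eq_bigr => m _.
by rewrite linearZ /= -ordered_eval_pbw exponentsK.
Qed.

(** Turns the PBW property into bijectivity of a linear map, which can be transported along
    automorphisms of the polynomial ring. *)
Lemma pbw_basisP x :
  is_basis (pbw_monomial x) <->
  injective (ordered_eval x) /\ forall v, exists p, ordered_eval x p = v.
Proof.
split=> [[span free]|[inj surj]].
  split=> [|v].
    apply: raddf_inj => p; rewrite /= ordered_evalE => p0; apply/mpolyP => m.
    rewrite mcoeff0; have [m_p|/memN_msupp_eq0 //] := boolP (m \in msupp p).
    have := free (map exponents (msupp p)) (fun t => p@_(multinom_of t)).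
    rewrite (map_inj_uniq (can_inj exponentsK)) msupp_uniq big_map.
    under eq_bigr => k _ do rewrite exponentsK.
    move=> /(_ isT p0 (exponents m)); rewrite exponentsK; apply.
    exact: map_f.
  have [s [c ->]] := span v.
  exists (\sum_(t <- s) c t *: 'X_[multinom_of t]).
  by rewrite linear_sum; apply: eq_bigr => t _; rewrite linearZ /= ordered_eval_pbw.
split=> [v|s c s_uniq s0 t t_s].
  have [p <-] := surj v.
  exists (map exponents (msupp p)), (fun t => p@_(multinom_of t)).
  rewrite ordered_evalE [RHS]big_map.
  by apply: eq_bigr => m _; rewrite exponentsK.
have: \sum_(t <- s) c t *: 'X_[multinom_of t] = 0 :> {mpoly K[3]}.
  apply: inj; rewrite linear0 linear_sum -[RHS]s0; apply: eq_bigr => u _.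
  by rewrite linearZ /= ordered_eval_pbw.
move=> /(congr1 (mcoeff (multinom_of t))); rewrite mcoeff0 raddf_sum /=.
rewrite (bigD1_seq t) //= mcoeffZ mcoeffX eqxx mulr1 big1 ?addr0 // => u u_t.
by rewrite mcoeffZ mcoeffX (inj_eq (can_inj multinom_ofK)) (negbTE u_t) mulr0.
Qed.

Lemma pbw_coordinate x : is_basis (pbw_monomial x) ->
  exists phi : nat * nat * nat -> {scalar A},
    forall t u, phi t (pbw_monomial x u) = (t == u)%:R.
Proof.
move=> /pbw_basisP[inj surj].
(* [xchoose] selects from a boolean predicate, hence the form with [==]. *)
have surjb v : exists p, ordered_eval x p == v.
  by have [p <-] := surj v; exists p.
pose inv v := xchoose (surjb v).
have invK v : ordered_eval x (inv v) = v by apply/eqP/(xchooseP (surjb v)).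
have evK p : inv (ordered_eval x p) = p by apply: inj; rewrite invK.
pose coord t v : K := (inv v)@_(multinom_of t).
have coord_linear t : scalar (coord t).
  move=> c v w; rewrite /coord -[v in LHS]invK -[w in LHS]invK.
  by rewrite -linearP evK mcoeffD mcoeffZ.
pose mix t := GRing.isLinear.Build K A K *%R (coord t) (coord_linear t).
exists (fun t => HB.pack_for {scalar A} (coord t) (mix t)).
move=> t u; rewrite /= /coord -ordered_eval_pbw evK mcoeffX.
by rewrite eq_sym (inj_eq (can_inj multinom_ofK)).
Qed.

End PBW.

(** Serves for the uniqueness of ring morphisms out of [A] and for the centrality of [C]. *)
Lemma pbw_span_ind (K : fieldType) (A : algType K) (x : 'I_3 -> A) (P : A -> Prop) :
    is_basis (pbw_monomial x) ->
    (forall u v, P u -> P v -> P (u + v)) -> (forall u v, P u -> P v -> P (u * v)) ->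
    (forall c, P c%:A) -> (forall i, P (x i)) -> forall z, P z.
Proof.
move=> [span _] PD PM PC Px z; have [s [c ->]] := span z.
have P0 : P 0 by rewrite -(scale0r 1); apply: PC.
have P1 : P 1 by rewrite -(scale1r 1); apply: PC.
have PX i k : P (x i ^+ k).
  by elim: k => [|k Pk]; rewrite ?expr0 // exprS; apply: (PM).
apply: (big_ind P P0 PD) => t _; rewrite -mulr_algl.
by apply: (PM) => //; rewrite /pbw_monomial; do 2! apply: (PM) => //.
Qed.

(** * Affine changes of generators *)

Section AffineChange.
Variable K : fieldType.
Implicit Types (Q B : 'rV[K]_3) (M : 'M[K]_3) (l m : 'I_3 -> K).

(* Row [i] of Q, M, B concerns the generators [pair_low i] < [pair_high i]. *)
Definition pair_low (i : 'I_3) : 'I_3 := if i == 2 then 1 else 0.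
Definition pair_high (i : 'I_3) : 'I_3 := if i == 0 then 1 else 2.

(** A form uniform in the row, so that the effect of an affine change is computed only once. *)
Lemma biquadratic_relationsE Q M B (E : algType K) (x : 'I_3 -> E) :
  biquadratic_relations Q M B x <->
  forall i, x (pair_high i) * x (pair_low i)
              - Q 0 i *: (x (pair_low i) * x (pair_high i)) =
            \sum_k M i k *: x k + (B 0 i)%:A.
Proof.
have sum3 (F : 'I_3 -> E) : \sum_k F k = F 0 + F 1 + F 2.
  rewrite !big_ord_recr big_ord0 /= add0r.
  by congr (F _ + F _ + F _); apply: val_inj.
split=> [[r10 r20 r21] i|r].
  by rewrite sum3; case: (ord3_cases i) => ->.
by split; [have := r 0|have := r 1|have := r 2]; rewrite sum3.
Qed.

(** With [h], [s] the high and low generators of row [i], substituting y_k = l_k x_k + m_k scales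
    the old linear part by l_h l_s, and dividing by l_k rewrites it in y_k. The translation adds (1
    - q)(m_s y_h + m_h y_s). *)
Definition affine_matrix Q M l m : 'M[K]_3 :=
  \matrix_(i, k) (l (pair_high i) * l (pair_low i) * M i k / l k
    + (1 - Q 0 i) * (m (pair_low i) * (k == pair_high i)%:R
                     + m (pair_high i) * (k == pair_low i)%:R)).

(** The subtracted sum appears because the linear part is naturally in l_k x_k = y_k - m_k. *)
Definition affine_row Q M B l m : 'rV[K]_3 :=
  \row_i (l (pair_high i) * l (pair_low i) * B 0 i
    + (1 - Q 0 i) * (m (pair_low i) * m (pair_high i))
    - \sum_k affine_matrix Q M l m i k * m k).

(** In each row the defect of the new relation is the nonzero scalar l_h l_s times the defect of the
    old one, which gives both directions at once. *)
Lemma affine_relations Q M B l m (E : algType K) (x : 'I_3 -> E) :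
  (forall i, l i != 0) ->
  biquadratic_relations Q (affine_matrix Q M l m) (affine_row Q M B l m)
    (fun i => l i *: x i + (m i)%:A) <->
  biquadratic_relations Q M B x.
Proof.
move=> l_neq0; set y := fun i => _.
suff step i : y (pair_high i) * y (pair_low i)
      - Q 0 i *: (y (pair_low i) * y (pair_high i))
      - (\sum_k affine_matrix Q M l m i k *: y k + (affine_row Q M B l m 0 i)%:A)
    = (l (pair_high i) * l (pair_low i)) *:
      (x (pair_high i) * x (pair_low i)
       - Q 0 i *: (x (pair_low i) * x (pair_high i))
       - (\sum_k M i k *: x k + (B 0 i)%:A)).
  rewrite !biquadratic_relationsE; split=> r i; apply/eqP; rewrite -subr_eq0.
    have /eqP := step i; rewrite r subrr eq_sym scaler_eq0 mulf_eq0.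
    by rewrite !(negbTE (l_neq0 _)).
  by rewrite step r subrr scaler0.
rewrite /affine_row mxE.
set h := pair_high i; set s := pair_low i; set q := Q 0 i.
set M' := affine_matrix _ _ _ _.
have M'y : \sum_k M' i k *: y k =
    (l h * l s) *: (\sum_k M i k *: x k)
    + ((1 - q) * m s * l h) *: x h + ((1 - q) * m h * l s) *: x s
    + (\sum_k M' i k * m k)%:A.
  have pick (j : 'I_3) (c : K) : c *: x j = \sum_k (c * (k == j)%:R) *: x k.
    rewrite (bigD1 j) //= eqxx mulr1 big1 ?addr0 // => k /negbTE->.
    by rewrite mulr0 scale0r.
  rewrite (pick h) (pick s) scaler_sumr scaler_suml -!big_split /=.
  apply: eq_bigr => k _; rewrite scalerDr !scalerA -!scalerDl.
  congr (_ *: _ + _); rewrite /M' mxE -/h -/s -/q.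
  (* Where the delta is nonzero, [l j] is the coefficient [l k] of x_k in y_k. *)
  have at_j (j : 'I_3) : l j * (k == j)%:R = l k * (k == j)%:R.
    by case: eqP => [->|]; rewrite ?mulr0.
  rewrite -[_ * m s * l h * _]mulrA -[_ * m h * l s * _]mulrA !at_j.
  by field; apply: l_neq0.
have expand (u v : 'I_3) : y u * y v = (l u * l v) *: (x u * x v)
    + ((l u * m v) *: x u + (l v * m u) *: x v + (m u * m v)%:A).
  rewrite /y mulrDl !mulrDr -!scalerAl -!scalerAr !mul1r mulr1 !scalerA.
  by rewrite -!addrA [m u * l v]mulrC.
have {}expand : y h * y s - q *: (y s * y h) =
    (l h * l s) *: (x h * x s - q *: (x s * x h))
    + (1 - q) *: ((l h * m s) *: x h + (l s * m h) *: x s + (m h * m s)%:A).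
  rewrite !expand [l s * l h]mulrC [m s * m h]mulrC.
  rewrite [(l s * m h) *: _ + _]addrC; set V := _ + _%:A.
  by rewrite scalerBr scalerBl scale1r scalerDr opprD !scalerA [_ * q]mulrC addrACA.
rewrite expand M'y; set S := \sum_k M i k *: x k; set P := \sum_k _.
rewrite [RHS]scalerBr (scalerDr _ S).
have -> : (1 - q) *: ((l h * m s) *: x h + (l s * m h) *: x s + (m h * m s)%:A) =
    ((1 - q) * m s * l h) *: x h + ((1 - q) * m h * l s) *: x s
    + ((1 - q) * (m s * m h))%:A.
  by rewrite !scalerDr !scalerA; congr (_ *: _ + _ *: _ + _ *: _); ring.
rewrite [(_ - P)%:A]scalerBl [(_ + _)%:A]scalerDl -(scalerA _ (B 0 i)).
rewrite [_ + P%:A + _]addrACA subrr addr0 -(addrA (_ *: S)).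
set T := _ *: S; set V := _ + _ *: x s.
by rewrite [T + V + _]addrACA [T + _ + _]addrC opprD addrA addrK.
Qed.

Lemma affine_basis (A : algType K) (x : 'I_3 -> A) l m : (forall i, l i != 0) ->
  is_basis (pbw_monomial x) ->
  is_basis (pbw_monomial (fun i => l i *: x i + (m i)%:A)).
Proof.
move=> l_neq0 /pbw_basisP[inj surj]; apply/pbw_basisP.
have lV_neq0 i : (l i)^-1 != 0 by rewrite invr_eq0.
split=> [p q|v].
  by rewrite !ordered_eval_affine => /inj /(can_inj (comp_affineK m l_neq0)).
have [p <-] := surj v.
exists (comp_mpoly (affine_tuple (fun i => (l i)^-1) (fun i => - (m i / l i))) p).
rewrite ordered_eval_affine; congr ordered_eval.
(* Surjectivity needs the other composite: this is cancellation for the inverse parameters, whose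
   own inverse is again [(l, m)]. *)
have := comp_affineK (fun i => - (m i / l i)) lV_neq0 p.
rewrite (_ : affine_tuple (fun i => (l i)^-1^-1) _ = affine_tuple l m) //.
apply: eq_mktuple => i; rewrite invrK; congr (_ + _%:MP).
by rewrite mulNr opprK divfK ?invr_neq0.
Qed.

Lemma affine_biquadratic Q M B (A : algType K) (x : 'I_3 -> A) l m :
  (forall i, l i != 0) -> biquadratic_algebra Q M B x ->
  biquadratic_algebra Q (affine_matrix Q M l m) (affine_row Q M B l m)
    (fun i => l i *: x i + (m i)%:A).
Proof.
move=> l_neq0 [Q_neq0 [rel_x lift] basis_x]; split=> //; last exact: affine_basis.
split=> [|E y rel_y]; first exact/affine_relations.
(* Undoing the change inside [E] turns a solution of the new relations into one of the old, to which
   [lift] applies. *)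
pose z i := (l i)^-1 *: (y i - (m i)%:A).
have zE i : l i *: z i + (m i)%:A = y i.
  by rewrite scalerA divff // scale1r subrK.
have [|f [fx f_uniq]] := lift E z.
  apply/(affine_relations Q M B m z l_neq0); move: rel_y.
  by rewrite (_ : y = fun i => l i *: z i + (m i)%:A) //; apply/funext => i.
have affineE (g : {lrmorphism A -> E}) c d u : g (c *: u + d%:A) = c *: g u + d%:A.
  by rewrite linearD !linearZ rmorph1.
exists f; split=> [i|g gy]; first by rewrite affineE fx.
by apply: f_uniq => i; rewrite /z -gy affineE addrK scalerA mulVf // scale1r.
Qed.

End AffineChange.

(** * Normal forms *)

Section Diamond.
Variables (K : fieldType) (A : algType K) (x : 'I_3 -> A).
Variables (q1 q2 c be ga la mu nu b1 b2 b3 : K).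
Hypotheses (q1_neq0 : q1 != 0) (q2_neq0 : q2 != 0).
Hypotheses (q1_neq1 : q1 != 1) (q2_neq1 : q2 != 1).
Hypothesis basis_x : is_basis (pbw_monomial x).
Hypothesis x10 : x 1 * x 0 = q1 *: (x 0 * x 1) + c *: x 2 + b1%:A.
Hypothesis x20 : x 2 * x 0 = q2 *: (x 0 * x 2) + be *: x 1 + ga *: x 2 + b2%:A.
Hypothesis x21 :
  x 2 * x 1 = x 1 * x 2 + la *: x 0 + mu *: x 1 + nu *: x 2 + b3%:A.

Lemma overlap_coefficients :
  [/\ [/\ c = 0, be = 0 & ga = 0], [/\ mu = 0, nu = 0, b1 = 0 & b2 = 0],
      (1 - q1 * q2) * la = 0 & (1 - q1 * q2) * b3 = 0].
Proof.
(* The overlap of the leading monomials of the three relations. *)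
have /esym E := mulrA (x 2) (x 1) (x 0).
rewrite x21 x10 !(mulrDl, mulrDr) -!scalerAl -!scalerAr !mul1r !mulr1 in E.
rewrite -[x 1 * x 2 * x 0]mulrA [x 2 * (x 0 * x 1)]mulrA x20 in E.
rewrite !(mulrDl, mulrDr) -!scalerAl -!scalerAr !mul1r !mulr1 in E.
rewrite mulrA x10 -[x 0 * x 2 * x 1]mulrA x21 in E.
rewrite !(mulrDl, mulrDr) -!scalerAl -!scalerAr !mul1r !mulr1 mulrA in E.
(* Both sides of [E] are now combinations of ordered monomials; naming these by exponents lets the
   coordinate forms be applied. *)
pose e := pbw_monomial x.
have m111 : x 0 * x 1 * x 2 = e (1, 1, 1)%N by [].
have m200 : x 0 * x 0 = e (2, 0, 0)%N by rewrite /e /pbw_monomial !expr0 !mulr1.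
have m110 : x 0 * x 1 = e (1, 1, 0)%N by rewrite /e /pbw_monomial expr0 mulr1.
have m101 : x 0 * x 2 = e (1, 0, 1)%N by rewrite /e /pbw_monomial expr0 mulr1.
have m020 : x 1 * x 1 = e (0, 2, 0)%N by rewrite /e /pbw_monomial !expr0 mul1r mulr1.
have m011 : x 1 * x 2 = e (0, 1, 1)%N by rewrite /e /pbw_monomial expr0 mul1r.
have m002 : x 2 * x 2 = e (0, 0, 2)%N by rewrite /e /pbw_monomial !expr0 !mul1r.
have m100 : x 0 = e (1, 0, 0)%N by rewrite /e /pbw_monomial !expr0 !mulr1.
have m010 : x 1 = e (0, 1, 0)%N by rewrite /e /pbw_monomial !expr0 mul1r mulr1.
have m001 : x 2 = e (0, 0, 1)%N by rewrite /e /pbw_monomial !expr0 !mul1r.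
have m000 : 1 = e (0, 0, 0)%N by rewrite /e /pbw_monomial !expr0 !mul1r.
rewrite m111 m200 m110 m101 m020 m011 m002 m100 m010 m001 m000 in E.
have [phi [phiD phiZ phiE]] : exists phi : nat * nat * nat -> A -> K,
    [/\ forall t, {morph phi t : u v / u + v}, forall t k u, phi t (k *: u) = k * phi t u
      & forall t u, phi t (pbw_monomial x u) = (t == u)%:R].
  have [phi phiE] := pbw_coordinate basis_x; exists phi.
  by split=> // t; [apply: linearD|move=> k u; apply: linearZ].
have at_ t := congr1 (phi t) E.
have := at_ (0, 0, 1)%N; rewrite !(phiD, phiZ) !phiE /=
  !(mulr0, mulr1, addr0, add0r) => b1E.
have := at_ (0, 1, 0)%N; rewrite !(phiD, phiZ) !phiE /=
  !(mulr0, mulr1, addr0, add0r) => b2E.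
have := at_ (1, 0, 0)%N; rewrite !(phiD, phiZ) !phiE /=
  !(mulr0, mulr1, addr0, add0r) => b3E.
have := at_ (1, 0, 1)%N; rewrite !(phiD, phiZ) !phiE /=
  !(mulr0, mulr1, addr0, add0r) => nuE.
have := at_ (1, 1, 0)%N; rewrite !(phiD, phiZ) !phiE /=
  !(mulr0, mulr1, addr0, add0r) => muE.
have := at_ (2, 0, 0)%N; rewrite !(phiD, phiZ) !phiE /=
  !(mulr0, mulr1, addr0, add0r) => laE.
have := at_ (0, 1, 1)%N; rewrite !(phiD, phiZ) !phiE /=
  !(mulr0, mulr1, addr0, add0r) => gaE.
have := at_ (0, 2, 0)%N; rewrite !(phiD, phiZ) !phiE /=
  !(mulr0, mulr1, addr0, add0r) => beE.
have := at_ (0, 0, 2)%N; rewrite !(phiD, phiZ) !phiE /=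
  !(mulr0, mulr1, addr0, add0r) => cE.
(* All parameters but [la] and [b3] are fixed by multiplication by [q1] or [q2], up to a nonzero
   factor. For [la] and [b3] the multiplier is [q1 * q2], which may be 1, so only a product is known
   to vanish. *)
have fixed0 (q z : K) : q != 1 -> z = q * z -> z = 0.
  rewrite -subr_eq0 => q_neq1 zE; apply/eqP; rewrite -(mulrI_eq0 _ (mulfI q_neq1)).
  by rewrite mulrBl mul1r -zE subrr.
have c0 := fixed0 _ _ q2_neq1 (esym cE); have be0 := fixed0 _ _ q1_neq1 beE.
have ga0 := fixed0 _ _ q1_neq1 gaE.
(* The mixed products in the coefficients of x_1, x_2, x_3 all contain [c], [be] or [ga]; without
   them each equation involves a single constant. *)
rewrite c0 be0 ga0 !(mul0r, mulr0, addr0, add0r) in b3E b2E b1E *.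
have mu0 : mu = 0.
  by apply: (fixed0 _ _ q2_neq1); apply: (mulfI q1_neq0); rewrite -muE mulrC.
have nu0 : nu = 0.
  by apply: (fixed0 _ _ q1_neq1); apply: (mulfI q2_neq0); rewrite mulrC nuE; ring.
split; [by []| |rewrite mulrBl mul1r -mulrA -laE subrr|]; first last.
- by rewrite mulrBl mul1r -mulrA -b3E subrr.
- by [].
split=> //; first by apply: (fixed0 _ _ q2_neq1).
exact: (fixed0 _ _ q1_neq1).
Qed.

End Diamond.

Lemma affine_normal_form (K : fieldType) (q1 q2 : K) (M : 'M[K]_3) (B : 'rV[K]_3)
    (A : algType K) (x : 'I_3 -> A) :
  q1 != 1 -> q2 != 1 -> biquadratic_algebra (row3 q1 q2 1) M B x ->
  exists (m : 'I_3 -> K) (la b3 : K),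
    [/\ biquadratic_algebra (row3 q1 q2 1) (la *: delta_mx 2 0) (row3 0 0 b3)
           (fun i => 1 *: x i + (m i)%:A),
        (1 - q1 * q2) * la = 0 & (1 - q1 * q2) * b3 = 0].
Proof.
move=> q1_neq1 q2_neq1 x_biq.
have q1'_neq0 : 1 - q1 != 0 by rewrite subr_eq0 eq_sym.
have q2'_neq0 : 1 - q2 != 0 by rewrite subr_eq0 eq_sym.
(* Translation adds [(1 - q1) * m 1] and [(1 - q1) * m 0] to a and b, and [(1 - q2) * m 2] to alpha;
   these values cancel all three. *)
pose m (i : 'I_3) := [:: - (M 0 1 / (1 - q1)); - (M 0 0 / (1 - q1));
                          - (M 1 0 / (1 - q2))]`_i.
have l_neq0 (i : 'I_3) : (fun=> 1 : K) i != 0 by apply: oner_neq0.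
have := affine_biquadratic m l_neq0 x_biq.
set M' := affine_matrix _ _ _ _; set B' := affine_row _ _ _ _ _.
set y := fun i => _ => y_biq.
have M'00 : M' 0 0 = 0.
  by rewrite mxE /= row3E /m /=; field; rewrite q1'_neq0 oner_neq0.
have M'01 : M' 0 1 = 0.
  by rewrite mxE /= row3E /m /=; field; rewrite q1'_neq0 oner_neq0.
have M'10 : M' 1 0 = 0.
  by rewrite mxE /= row3E /m /=; field; rewrite ?q1'_neq0 ?q2'_neq0 oner_neq0.
clearbody M' B'.
have [Q_neq0 [[r10 r20 r21] _] y_basis] := y_biq.
rewrite row3E M'00 M'01 !scale0r !add0r in r10.
rewrite row3E M'10 scale0r add0r in r20.
rewrite row3E scale1r in r21.
have := @overlap_coefficients _ _ y q1 q2 (M' 0 2) (M' 1 1) (M' 1 2)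
  (M' 2 0) (M' 2 1) (M' 2 2) (B' 0 0) (B' 0 1) (B' 0 2).
case=> //.
- by have := Q_neq0 0; rewrite row3E.
- by have := Q_neq0 1; rewrite row3E.
- by rewrite (canRL (subrK _) r10) addrC addrA.
- by rewrite (canRL (subrK _) r20) addrC !addrA.
- by rewrite (canRL (subrK _) r21) addrC !addrA.
move=> [M'02 M'11 M'12] [M'21 M'22 B'0 B'1] la0 b0.
exists m, (M' 2 0), (B' 0 2); split=> //.
suff [<- <-] : M' = M' 2 0 *: delta_mx 2 0 /\ B' = row3 0 0 (B' 0 2) by [].
split.
  apply/matrixP => i j; rewrite !mxE.
  by case: (ord3_cases i) => ->; case: (ord3_cases j) => ->;
    rewrite /= ?(M'00, M'01, M'10, M'02, M'11, M'12, M'21, M'22) ?(mulr0, mulr1).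
by apply/rowP => i; case: (ord3_cases i) => ->; rewrite row3E.
Qed.

Lemma rescale_normal_form (K : fieldType) (q1 q2 la b3 : K) (A : algType K)
    (x : 'I_3 -> A) :
  biquadratic_algebra (row3 q1 q2 1) (la *: delta_mx 2 0) (row3 0 0 b3) x ->
  exists (l : 'I_3 -> K) (la' b3' : K),
    [/\ forall i, l i != 0, la' = 0 \/ la' = 1, b3' = 0 \/ b3' = 1
      & biquadratic_algebra (row3 q1 q2 1) (la' *: delta_mx 2 0) (row3 0 0 b3')
          (fun i => l i *: x i + 0%:A)].
Proof.
(* With x_2 unscaled, [b3] is multiplied by [l2] and [la] by [l2 / l0]: [l2] normalizes [b3] first,
   then [l0] normalizes [la]. A zero coefficient leaves the choice free, and 1 is taken. *)
pose l2 := if b3 == 0 then 1 else b3^-1.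
pose l0 := if la == 0 then 1 else l2 * la.
have l2_neq0 : l2 != 0.
  by rewrite /l2; case: ifPn => [_|b3_neq0]; rewrite ?invr_eq0 ?oner_neq0.
have l0_neq0 : l0 != 0.
  by rewrite /l0; case: ifPn => [_|la_neq0]; rewrite ?mulf_neq0 ?oner_neq0.
pose l (i : 'I_3) := [:: l0; 1; l2]`_i.
have l_neq0 i : l i != 0.
  by case: (ord3_cases i) => ->; rewrite /l //= oner_neq0.
move=> /(affine_biquadratic (fun=> 0) l_neq0) H.
exists l, (l2 * la / l0), (l2 * b3); split=> //.
- rewrite /l0; case: (eqVneq la 0) => [->|la_neq0]; first by left; rewrite mulr0 mul0r.
  by right; rewrite divff // mulf_neq0.
- rewrite /l2; case: (eqVneq b3 0) => [->|b3_neq0]; first by left; rewrite mulr0.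
  by right; rewrite mulVf.
have <- : affine_matrix (row3 q1 q2 1) (la *: delta_mx 2 0) l (fun=> 0) =
    (l2 * la / l0) *: delta_mx 2 0.
  apply/matrixP => i j; rewrite !mxE !mul0r addr0 mulr0 addr0.
  by case: (ord3_cases i) => ->; case: (ord3_cases j) => ->;
    rewrite /l /= ?(mulr0, mulr1, mul0r).
suff <- : affine_row (row3 q1 q2 1) (la *: delta_mx 2 0) (row3 0 0 b3) l (fun=> 0) =
    row3 0 0 (l2 * b3) by [].
apply/rowP => i; rewrite mxE big1 => [|k _]; last exact: mulr0.
by case: (ord3_cases i) => ->; rewrite !row3E /l /= !(mulr0, mulr1, mul0r, addr0, subr0).
Qed.

Lemma presented_isomorphic (K : fieldType) n
    (rel : forall E : algType K, ('I_n -> E) -> Prop) (A E : algType K)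
    (x : 'I_n -> A) (y : 'I_n -> E) :
  algebra_presented_by rel x -> algebra_presented_by rel y ->
  algebra_isomorphic A E.
Proof.
move=> [rel_x lift_x] [rel_y lift_y].
have [f [fx _]] := lift_x _ _ rel_y; have [g [gy _]] := lift_y _ _ rel_x.
have [h [_ h_uniq]] := lift_x _ _ rel_x; have [k [_ k_uniq]] := lift_y _ _ rel_y.
exists f; exists g => u.
  rewrite [LHS](h_uniq (g \o f)) => [|i]; last by rewrite /= fx gy.
  by apply/esym; apply: (h_uniq idfun).
rewrite [LHS](k_uniq (f \o g)) => [|i]; last by rewrite /= gy fx.
by apply/esym; apply: (k_uniq idfun).
Qed.

(** * Morphisms into arbitrary rings *)

Section ScalarCentralizer.
Variables (K : comNzRingType) (A : algType K) (S : pzRingType).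
Variable f : {rmorphism K -> S}.

(* The factor [A] makes the ring nonzero even if [S] is trivial, and provides a
   second coordinate in which any relations satisfied in [A] hold. *)
Definition scalar_centralizer : {pred S * A} :=
  fun s => `[< forall c, GRing.comm s.1 (f c) >].

Fact scalar_centralizer_subring_closed : subring_closed scalar_centralizer.
Proof.
split=> [|s t /asboolP hs /asboolP ht|s t /asboolP hs /asboolP ht];
  apply/asboolP=> c /=.
- exact/commr_sym/commr1.
- by apply/commr_sym/commrB; apply/commr_sym.
- by apply/commr_sym/commrM; apply/commr_sym.
Qed.

Record scalar_centralizer_type :=
  ScalarCentralizer { scent_val :> S * A; _ : scent_val \in scalar_centralizer }.

HB.instance Definition _ := [isSub for scent_val].
HB.instance Definition _ := [Choice of scalar_centralizer_type by <:].
HB.instance Definition _ :=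
  GRing.SubChoice_isSubPzRing.Build (S * A)%type scalar_centralizer
    scalar_centralizer_type scalar_centralizer_subring_closed.

Fact scalar_centralizer_nonzero : (1 : scalar_centralizer_type) != 0.
Proof.
apply/eqP=> /(congr1 (fun s : scalar_centralizer_type => (val s).2)).
by rewrite rmorph1 raddf0 => /eqP; rewrite oner_eq0.
Qed.

HB.instance Definition _ := GRing.PzSemiRing_isNonZero.Build
  scalar_centralizer_type scalar_centralizer_nonzero.

Fact scent_scale_subproof (c : K) (s : scalar_centralizer_type) :
  (f c * (val s).1, c *: (val s).2) \in scalar_centralizer.
Proof.
apply/asboolP=> d /=; apply/commr_sym/commrM; last first.
  by have /asboolP hs := valP s; apply/commr_sym/hs.
by rewrite /GRing.comm -!rmorphM mulrC.
Qed.

Definition scent_scale c s := ScalarCentralizer (scent_scale_subproof c s).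

Fact scent_scaleA a b s : scent_scale a (scent_scale b s) = scent_scale (a * b) s.
Proof. by apply: val_inj; rewrite /= mulrA -rmorphM scalerA. Qed.

Fact scent_scale1 : left_id 1 scent_scale.
Proof.
by move=> s; apply: val_inj; rewrite /= rmorph1 mul1r scale1r -surjective_pairing.
Qed.

Fact scent_scaleDr : right_distributive scent_scale +%R.
Proof. by move=> c s t; apply: val_inj; rewrite /= mulrDr scalerDr. Qed.

Fact scent_scaleDl s : {morph scent_scale^~ s : c d / c + d}.
Proof. by move=> c d; apply: val_inj; rewrite /= rmorphD mulrDl scalerDl. Qed.

HB.instance Definition _ := GRing.Zmodule_isLmodule.Build K
  scalar_centralizer_type scent_scaleA scent_scale1 scent_scaleDr scent_scaleDl.

Fact scent_scaleAl (c : K) (s t : scalar_centralizer_type) :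
  c *: (s * t) = c *: s * t.
Proof. by apply: val_inj; congr (_, _); rewrite /= (mulrA, scalerAl). Qed.

HB.instance Definition _ := GRing.Lmodule_isLalgebra.Build K
  scalar_centralizer_type scent_scaleAl.

(** The axiom for which [S] is cut down to a centralizer: [f c] has to pass the first coordinate of
    [s]. *)
Fact scent_scaleAr (c : K) (s t : scalar_centralizer_type) :
  c *: (s * t) = s * (c *: t).
Proof.
apply: val_inj; congr (_, _); rewrite /= ?scalerAr // !mulrA.
by have /asboolP -> := valP s.
Qed.

HB.instance Definition _ := GRing.Lalgebra_isAlgebra.Build K
  scalar_centralizer_type scent_scaleAr.

Definition scent_fst (s : scalar_centralizer_type) : S := (val s).1.

Fact scent_fst_zmod_morphism : zmod_morphism scent_fst.
Proof. by []. Qed.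

Fact scent_fst_monoid_morphism : monoid_morphism scent_fst.
Proof. by []. Qed.

HB.instance Definition _ := GRing.isZmodMorphism.Build
  scalar_centralizer_type S scent_fst scent_fst_zmod_morphism.
HB.instance Definition _ := GRing.isMonoidMorphism.Build
  scalar_centralizer_type S scent_fst scent_fst_monoid_morphism.

Lemma scent_fst_alg c : scent_fst c%:A = f c.
Proof. exact: mulr1. Qed.

End ScalarCentralizer.
Arguments scalar_centralizer {K} A {S} f.
Arguments scalar_centralizer_type {K} A {S} f.

(** Scalars enter through [f] and left multiplication, as [S] carries no [K]-algebra structure. *)
Definition relations_over (K : fieldType) (Q : 'rV[K]_3) (M : 'M[K]_3)
    (B : 'rV[K]_3) (S : pzRingType) (f : K -> S) (y : 'I_3 -> S) : Prop :=
  let rhs (i : 'I_3) : S :=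
    f (M i 0) * y 0 + f (M i 1) * y 1 + f (M i 2) * y 2 + f (B 0 i) in
  [/\ y 1 * y 0 - f (Q 0 0) * (y 0 * y 1) = rhs 0,
      y 2 * y 0 - f (Q 0 1) * (y 0 * y 2) = rhs 1
    & y 2 * y 1 - f (Q 0 2) * (y 1 * y 2) = rhs 2].

(** The pairs [(y i, x i)] satisfy the relations, by hypothesis in the first coordinate and by those
    of [A] in the second. The lift to the centralizer is then projected to [S]. *)
Lemma biquadratic_ring_lift (K : fieldType) (Q : 'rV[K]_3) (M : 'M[K]_3)
    (B : 'rV[K]_3) (A : algType K) (x : 'I_3 -> A) (S : pzRingType)
    (f : {rmorphism K -> S}) (y : 'I_3 -> S) :
    algebra_presented_by (@biquadratic_relations K Q M B) x ->
    (forall i c, GRing.comm (y i) (f c)) -> relations_over Q M B f y ->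
  exists g : {rmorphism A -> S}, (forall c, g c%:A = f c) /\ forall i, g (x i) = y i.
Proof.
move=> [[x10 x20 x21] lift] y_comm [y10 y20 y21].
have hy i : (y i, x i) \in scalar_centralizer A f by apply/asboolP=> c; apply: y_comm.
pose z i : scalar_centralizer_type A f := ScalarCentralizer (hy i).
have {lift} [|g [gx _]] := lift (scalar_centralizer_type A f) z.
  by split; apply: val_inj; congr (_, _); rewrite //= mulr1.
exists (scent_fst (f := f) \o g : {rmorphism A -> S}); split=> [c|i] /=.
  by rewrite rmorph_alg scent_fst_alg.
by rewrite gx.
Qed.

(** * Presentations of the normal form *)

Section SkewAlgebra.
Variables (K : fieldType) (q lam b3 : K) (A : algType K) (x : 'I_3 -> A).
Hypothesis x_biq : biquadratic_algebra (row3 q q^-1 1) (lam *: delta_mx 2 0)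
  (row3 0 0 b3) x.

Let q_neq0 : q != 0.
Proof. by have [/(_ 0)] := x_biq; rewrite row3E. Qed.

Let skew_relationsP (S : pzRingType) (f : {rmorphism K -> S}) (y : 'I_3 -> S) :
  [/\ y 1 * y 0 = f q * (y 0 * y 1), y 2 * y 0 = f q^-1 * (y 0 * y 2)
    & y 2 * y 1 = y 1 * y 2 + (f lam * y 0 + f b3)] ->
  relations_over (row3 q q^-1 1) (lam *: delta_mx 2 0) (row3 0 0 b3) f y.
Proof.
case=> y10 y20 y21; split; rewrite !row3E !mxE /= ?(mulr0, mulr1) ?rmorph0 !mul0r !addr0.
- by rewrite y10 subrr.
- by rewrite y20 subrr.
by rewrite rmorph1 mul1r y21 addrC addKr.
Qed.

Lemma skew_relations :
  [/\ x 1 * x 0 = q *: (x 0 * x 1), x 2 * x 0 = q^-1 *: (x 0 * x 2)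
    & x 2 * x 1 = x 1 * x 2 + (lam *: x 0 + b3%:A)].
Proof.
have [_ [[r10 r20 r21] _] _] := x_biq.
rewrite !row3E !mxE /= ?(mulr0, mulr1) !scale0r !addr0 in r10 r20 r21.
split.
- exact: subr0_eq.
- exact: subr0_eq.
by rewrite (canRL (subrK _) r21) scale1r addrC.
Qed.

Lemma skew_ring_lift (S : pzRingType) (f : {rmorphism K -> S}) (X Y Z : S) :
    (forall c, [/\ GRing.comm X (f c), GRing.comm Y (f c) & GRing.comm Z (f c)]) ->
    Y * X = f q * (X * Y) -> Z * X = f q^-1 * (X * Z) ->
    Z * Y = Y * Z + (f lam * X + f b3) ->
  exists g : {rmorphism A -> S},
    [/\ forall c, g c%:A = f c, g (x 0) = X, g (x 1) = Y & g (x 2) = Z].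
Proof.
move=> comm_f YX ZX ZY; pose y (i : 'I_3) := nth 0 [:: X; Y; Z] i.
have [_ presented _] := x_biq.
have [||g [gC gx]] := @biquadratic_ring_lift _ _ _ _ _ _ _ f y presented.
- by move=> i c; have [? ? ?] := comm_f c; case: (ord3_cases i) => ->.
- exact: skew_relationsP.
by exists g; split=> //; rewrite gx.
Qed.

Lemma skew_rmorphism_ext (S : pzRingType) (g g' : {rmorphism A -> S}) :
  (forall c, g c%:A = g' c%:A) -> (forall i, g (x i) = g' (x i)) -> g =1 g'.
Proof.
move=> ggC ggx; have [_ _ basis_x] := x_biq.
apply: (pbw_span_ind basis_x) => // u v gu gv; first by rewrite !rmorphD gu gv.
by rewrite !rmorphM gu gv.
Qed.

Lemma skew_diskew_polynomial_ring :
  exists (iota : {lrmorphism {poly K} -> A})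
         (sigma sigma' : {lrmorphism {poly K} -> {poly K}}),
    [/\ iota 'X = x 0, sigma 'X = q^-1 *: 'X,
        cancel sigma sigma', cancel sigma' sigma
      & diskew_polynomial_ring iota (x 2) (x 1) sigma sigma' (lam *: 'X + b3%:P) 1].
Proof.
have [x10 x20 x21] := skew_relations.
have [iota iotaX] := poly_eval_lrmorphism (x 0).
have iotaC c : iota c%:P = c%:A by rewrite -alg_polyC linearZ rmorph1.
have iota_affine c d : iota (c *: 'X + d%:P) = c *: x 0 + d%:A.
  by rewrite linearD linearZ /= iotaX iotaC.
have [scaling [scalingX scalingC scalingK]] :
  exists scaling : K -> {lrmorphism {poly K} -> {poly K}},
    [/\ forall c, scaling c 'X = c *: 'X, forall c d, scaling c d%:P = d%:P
      & forall c d, c * d = 1 -> cancel (scaling c) (scaling d)].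
  exists (fun c => comp_poly (c *: 'X)); split=> [c|c d|c d cd p].
  - exact: comp_polyX.
  - exact: comp_polyC.
  rewrite /= -comp_polyA linearZ /= comp_polyX scalerA cd scale1r.
  exact: comp_polyXr.
have qK := scalingK _ _ (mulVf q_neq0); have qVK := scalingK _ _ (mulfV q_neq0).
exists iota, (scaling q^-1), (scaling q); split=> //.
split=> [d|d|]; first by rewrite /= mul1r mulr1 qK qVK.
  by rewrite /= qVK mulrC.
split=> [|S f u v [uf vf uv]].
  split.
  - apply: (@intertwine_poly _ _ iota (iota \o scaling q^-1)) => [c|].
      by rewrite /= scalingC iotaC mulr_algl mulr_algr.
    by rewrite /= scalingX linearZ /= iotaX x20 scalerAl.
  - apply: (@intertwine_poly _ _ iota (iota \o scaling q)) => [c|].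
      by rewrite /= scalingC iotaC mulr_algl mulr_algr.
    by rewrite /= scalingX linearZ /= iotaX x10 scalerAl.
  by rewrite rmorph1 mul1r x21 addrC addKr; apply/esym/iota_affine.
(* Test data over K[X] are scalars [f \o polyC] with three elements: the image of X for x_1, then
   [v] for x_2 and [u] for x_3. *)
have [||||g [gC g0 g1 g2]] :=
    @skew_ring_lift S (f \o polyC : {rmorphism K -> S}) (f 'X) v u.
- move=> c /=; split; rewrite /GRing.comm.
  + by rewrite -!rmorphM mulrC.
  + by rewrite vf /= scalingC.
  + by rewrite uf /= scalingC.
- by rewrite vf /= scalingX -mul_polyC rmorphM mulrA.
- by rewrite uf /= scalingX -mul_polyC rmorphM mulrA.
- move: uv; rewrite rmorph1 mul1r rmorphD -mul_polyC rmorphM => /= <-.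
  by rewrite addrC subrK.
have g_iota (g' : {rmorphism A -> S}) : (forall c, g' c%:A = f c%:P) ->
    g' (x 0) = f 'X -> forall d, g' (iota d) = f d.
  move=> g'C g'X d; rewrite -[LHS]mul1r -[RHS]mulr1.
  apply: (@intertwine_poly _ _ (g' \o iota) f) => [c|] /=.
    by rewrite mul1r mulr1 iotaC g'C.
  by rewrite mul1r mulr1 iotaX.
exists g; split=> [|g' [g'iota g'2 g'1]]; first by split=> //; apply: g_iota.
(* Scalars and x_1 both lie in the image of [iota], where [g'] is prescribed. *)
apply: skew_rmorphism_ext => [c|i]; first by rewrite gC -iotaC g'iota.
by case: (ord3_cases i) => ->; rewrite ?g'1 ?g'2 ?g1 ?g2 // -iotaX g'iota iotaX g0.
Qed.
(** The coefficient of x_1 in sigma(C) - C. It is [lam] for kappa = 0 and vanishes for kappa = lam /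
    (1 - q^-1) when q is not 1. *)
Let shift kappa := lam + kappa * (q^-1 - 1).
Let C kappa := x 1 * x 2 + kappa *: x 0.

(** Moving x_1 past x_3 and then x_2 produces the factors q^-1 and q, which cancel. *)
Lemma comm_x0_C kappa : GRing.comm (x 0) (C kappa).
Proof.
have [x10 x20 _] := skew_relations.
rewrite /GRing.comm mulrDr mulrDl -scalerAl -scalerAr; congr (_ + _).
rewrite -mulrA x20 -scalerAr [x 1 * (x 0 * x 2)]mulrA x10 -scalerAl scalerA.
by rewrite mulVf // scale1r mulrA.
Qed.

Lemma mul_x2_C kappa :
  x 2 * C kappa = (C kappa + (shift kappa *: x 0 + b3%:A)) * x 2.
Proof.
have [_ x20 x21] := skew_relations.
rewrite mulrDr mulrA x21 -scalerAr x20 scalerA !mulrDl -!scalerAl -!addrA.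
congr (_ + _); rewrite [RHS]addrA [_ + (kappa * _) *: _]addrC addrA -!scalerDl.
by congr (_ *: _ + _); rewrite /shift; ring.
Qed.

Lemma mul_x1_C kappa :
  x 1 * C kappa = (C kappa + (- (shift kappa * q) *: x 0 + (- b3)%:A)) * x 1.
Proof.
have [x10 _ x21] := skew_relations.
rewrite !mulrDl -mulrA x21 !mulrDr -!scalerAl -!scalerAr x10 !scalerA mulr1 mul1r.
rewrite -!addrA; congr (_ + _).
rewrite [b3 *: _ + _]addrC !addrA scaleNr -[RHS]addrA.
rewrite scaleNr addNr addr0 -scalerDl -scalerBl.
by congr (_ *: _); field.
Qed.

(** The right side is sigma(a) for a = C - kappa x_1, because shift(kappa) - kappa q^-1 = lam -
    kappa. *)
Lemma mul_x2_x1 kappa : x 2 * x 1 = C kappa + ((lam - kappa) *: x 0 + b3%:A).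
Proof.
have [_ _ x21] := skew_relations.
by rewrite x21 -addrA; congr (_ + _); rewrite addrA -scalerDl [kappa + _]addrC subrK.
Qed.

Lemma skew_classical_GWA kappa :
  exists (iota : {lrmorphism {mpoly K[2]} -> A})
         (sigma sigma' : {lrmorphism {mpoly K[2]} -> {mpoly K[2]}}),
    [/\ iota 'X_0 = x 0, iota 'X_1 = C kappa, sigma 'X_0 = q^-1 *: 'X_0,
        sigma 'X_1 = 'X_1 + (shift kappa *: 'X_0 + b3%:MP)
      & classical_GWA iota (x 2) (x 1) sigma sigma' ('X_1 - kappa *: 'X_0)].
Proof.
pose affine a c : {mpoly K[2]} := 'X_1 + (a *: 'X_0 + c%:MP).
(* These endomorphisms preserve the family [affine], so composites can be computed on the two
   parameters alone. *)
have endo a b c : exists s : {lrmorphism {mpoly K[2]} -> {mpoly K[2]}},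
    [/\ s 'X_0 = a *: 'X_0, s 'X_1 = affine b c, forall d, s d%:MP = d%:MP
      & forall b' c', s (affine b' c') = affine (b + b' * a) (c + c')].
  pose s : {lrmorphism {mpoly K[2]} -> {mpoly K[2]}} :=
    comp_mpoly [tuple a *: 'X_0; affine b c].
  have s0 : s 'X_0 = a *: 'X_0 by rewrite /s /= comp_mpolyXU.
  have s1 : s 'X_1 = affine b c by rewrite /s /= comp_mpolyXU.
  have sC d : s d%:MP = d%:MP by apply: comp_mpolyC.
  exists s; split=> // b' c'.
  rewrite linearD linearD linearZ /= s0 s1 sC -addrA; congr (_ + _).
  by rewrite addrACA scalerA -scalerDl -mpolyCD.
pose mu := shift kappa.
have [sigma [sigma0 sigma1 sigmaC sigma_aff]] := endo q^-1 mu b3.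
(* The parameters solve mu + b q^-1 = 0 and b3 + c = 0, making the composite fix X_1. *)
have [sigma' [sigma'0 sigma'1 sigma'C sigma'_aff]] := endo q (- (mu * q)) (- b3).
have endo_id (s : {rmorphism {mpoly K[2]} -> {mpoly K[2]}}) :
    (forall d, s d%:MP = d%:MP) -> s 'X_0 = 'X_0 -> s 'X_1 = 'X_1 -> s =1 id.
  move=> sC s0 s1; apply: (mpoly_rmorphism_ext (g := idfun)) => // i.
  by case: (ord2_cases i) => ->.
have sigmaK : cancel sigma sigma'.
  apply: (endo_id (sigma' \o sigma)) => [d||] /=; first by rewrite sigmaC sigma'C.
    by rewrite sigma0 linearZ /= sigma'0 scalerA mulVf // scale1r.
  by rewrite sigma1 sigma'_aff /affine !addNr scale0r mpolyC0 !addr0.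
have sigma'K : cancel sigma' sigma.
  apply: (endo_id (sigma \o sigma')) => [d||] /=; first by rewrite sigma'C sigmaC.
    by rewrite sigma'0 linearZ /= sigma0 scalerA mulfV // scale1r.
  by rewrite sigma'1 sigma_aff /affine mulNr mulfK // !subrr scale0r mpolyC0 !addr0.
have [|iota iotaE] := @mpoly_eval_lrmorphism _ _ 2 (fun i => nth 0 [:: x 0; C kappa] i).
  move=> i j; have x0C := comm_x0_C kappa.
  by case: (ord2_cases i) => ->; case: (ord2_cases j) => ->.
have iota0 : iota 'X_0 = x 0 by rewrite iotaE.
have iota1 : iota 'X_1 = C kappa by rewrite iotaE.
have iotaC d : iota d%:MP = d%:A by rewrite -alg_mpolyC linearZ rmorph1.
have iota_aff b c : iota (affine b c) = C kappa + (b *: x 0 + c%:A).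
  by rewrite linearD linearD linearZ /= iota0 iota1 iotaC.
have aE : 'X_1 - kappa *: 'X_0 = affine (- kappa) 0 by rewrite /affine addr0 scaleNr.
have sigma_aE : sigma ('X_1 - kappa *: 'X_0) = affine (lam - kappa) b3.
  by rewrite aE sigma_aff addr0 /mu /shift; congr affine; ring.
exists iota, sigma, sigma'; split=> //.
split=> //; first by move=> d; rewrite /GRing.comm mulrC.
split=> [|S f u v [uf vf vu uv]].
  have iota_sC s d (u : A) : (forall c, s c%:MP = c%:MP) ->
      u * iota d%:MP = iota (s d%:MP) * u.
    by move=> ->; rewrite iotaC mulr_algl mulr_algr.
  have [x10 x20 x21] := skew_relations.
  split.
  - apply: (@intertwine_mpoly _ _ _ iota (iota \o sigma)) => [c|i] /=.
      exact: iota_sC.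
    case: (ord2_cases i) => ->; last by rewrite sigma1 iota_aff iota1 mul_x2_C.
    by rewrite sigma0 linearZ /= iota0 x20 scalerAl.
  - apply: (@intertwine_mpoly _ _ _ iota (iota \o sigma')) => [c|i] /=.
      exact: iota_sC.
    case: (ord2_cases i) => ->; last by rewrite sigma'1 iota_aff iota1 mul_x1_C.
    by rewrite sigma'0 linearZ /= iota0 x10 scalerAl.
  - by rewrite /= aE iota_aff scale0r addr0 scaleNr /C addrK.
  - by rewrite /= sigma_aE iota_aff (mul_x2_x1 kappa).
have [||||g [gC g0 g1 g2]] :=
    @skew_ring_lift S (f \o @mpolyC 2 K : {rmorphism K -> S}) (f 'X_0) v u.
- move=> c /=; split; rewrite /GRing.comm.
  + by rewrite -!rmorphM mulrC.
  + by rewrite vf /= sigma'C.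
  + by rewrite uf /= sigmaC.
- by rewrite vf /= sigma'0 -mul_mpolyC rmorphM mulrA.
- by rewrite uf /= sigma0 -mul_mpolyC rmorphM mulrA.
(* The relation for x_3 x_2 comes from sigma(a) - a = lam X_0 + b3, with [u * v] and [v * u] the
   images of sigma(a) and a. *)
- rewrite uv vu /= sigma_aE aE -rmorphM -!rmorphD /= mul_mpolyC; congr (f _).
  rewrite /affine mpolyC0 addr0 -addrA; congr (_ + _).
  by rewrite addrA -scalerDl [- kappa + _]addrC.
have g_iota (g' : {rmorphism A -> S}) : (forall c, g' c%:A = f c%:MP) ->
    g' (x 0) = f 'X_0 -> g' (x 1) = v -> g' (x 2) = u -> forall d, g' (iota d) = f d.
  move=> g'C g'0 g'1 g'2; apply: (mpoly_rmorphism_ext (f := g' \o iota)) => [c|i] /=.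
    by rewrite iotaC g'C.
  case: (ord2_cases i) => ->; first by rewrite iota0.
  (* The value at X_1 is forced: C maps to v u + kappa f(X_0), and v u = f(X_1 - kappa X_0). *)
  rewrite iota1 rmorphD rmorphM -mulr_algl rmorphM g'C g'0 g'1 g'2 vu -rmorphM -rmorphD.
  by rewrite /= mul_mpolyC subrK.
exists g; split=> [|g' [g'iota g'2 g'1]]; first by split=> //; apply: g_iota.
apply: skew_rmorphism_ext => [c|i]; first by rewrite gC -iotaC g'iota.
by case: (ord3_cases i) => ->; rewrite ?g'1 ?g'2 ?g1 ?g2 // -iota0 g'iota iota0 g0.
Qed.
End SkewAlgebra.

(** * The cases of nonzero and zero 1 - q_1 q_2 *)

Theorem theorem1p6 (K : fieldType) (q1 q2 q3 : K) (M : 'M[K]_3) (B : 'rV[K]_3)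
    (A : algType K) (x : 'I_3 -> A)
    (hA : biquadratic_algebra (row3 q1 q2 q3) M B x)
    (hq1 : q1 != 1) (hq2 : q2 != 1) (hq3 : q3 = 1) :
  (1 - q1 * q2 != 0 ->
     (exists x' : 'I_3 -> A,
        G3_change x x' /\ quantum_space (row3 q1 q2 1) x') /\
     (forall (E : algType K) (y : 'I_3 -> E),
        quantum_space (row3 q1 q2 1) y -> algebra_isomorphic A E))
  /\
  (1 - q1 * q2 = 0 ->
     exists (x' : 'I_3 -> A) (lam b3 : K),
       [/\ G3_change x x',
           lam = 0 \/ lam = 1,
           b3 = 0 \/ b3 = 1
         & biquadratic_algebra (row3 q1 q1^-1 1)
             (lam *: delta_mx 2 0) (row3 0 0 b3) x']
       /\
       let x1 := x' 0 in let x2 := x' 1 in let x3 := x' 2 in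
       let h := x2 * x3 in
       [/\ (* A = K[x1][x3, x2; sigma, sigma^-1, b = lam x1 + b3, rho = 1] *)
           exists (iota : {lrmorphism {poly K} -> A})
                  (sigma sigma' : {lrmorphism {poly K} -> {poly K}}),
             [/\ iota 'X = x1, sigma 'X = q1^-1 *: 'X,
                 cancel sigma sigma', cancel sigma' sigma
               & diskew_polynomial_ring iota x3 x2 sigma sigma'
                   (lam *: 'X + b3%:P) 1],
           (* A = K[x1, h][x3, x2; sigma, a = h], with 'X_0, 'X_1 as x1, h *)
           exists (iota : {lrmorphism {mpoly K[2]} -> A})
                  (sigma sigma' : {lrmorphism {mpoly K[2]} -> {mpoly K[2]}}),
             [/\ iota 'X_0 = x1, iota 'X_1 = h,
                 sigma 'X_0 = q1^-1 *: 'X_0,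
                 sigma 'X_1 = 'X_1 + (lam *: 'X_0 + b3%:MP)
               & classical_GWA iota x3 x2 sigma sigma' 'X_1]
         & (* A = K[x1, C][x3, x2; sigma, a = C - alpha'] *)
           b3 = 0 ->
           let C := h + (lam * (1 - q1^-1)^-1) *: x1 in
           (forall z : A, GRing.comm C z) /\
           exists (iota : {lrmorphism {mpoly K[2]} -> A})
                  (sigma sigma' : {lrmorphism {mpoly K[2]} -> {mpoly K[2]}}),
             [/\ iota 'X_0 = x1, iota 'X_1 = C,
                 sigma 'X_0 = q1^-1 *: 'X_0, sigma 'X_1 = 'X_1
               & classical_GWA iota x3 x2 sigma sigma'
                   ('X_1 - (lam * (1 - q1^-1)^-1) *: 'X_0)]]).
Proof.
have {q3 hq3}hA : biquadratic_algebra (row3 q1 q2 1) M B x by rewrite -hq3.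
have [m [la [b [y_biq la0 b0]]]] := affine_normal_form hq1 hq2 hA.
split=> [q12_neq1|q12_eq1].
  have y_quantum : quantum_space (row3 q1 q2 1) (fun i => 1 *: x i + (m i)%:A).
    have : la = 0 by apply/eqP; rewrite -(mulrI_eq0 _ (mulfI q12_neq1)) la0.
    have : b = 0 by apply/eqP; rewrite -(mulrI_eq0 _ (mulfI q12_neq1)) b0.
    move=> b_eq0 la_eq0; rewrite /quantum_space; move: y_biq.
    rewrite la_eq0 b_eq0 scale0r (_ : row3 0 0 0 = 0) //.
    by apply/rowP => i; case: (ord3_cases i) => ->; rewrite row3E mxE.
  split=> [|E y [_ y_pres _]].
    eexists; split; last exact: y_quantum.
    by exists (fun=> 1), m; split=> // i; apply: oner_neq0.
  by have [_ x_pres _] := y_quantum; apply: presented_isomorphic x_pres y_pres.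
have [Q_neq0 _ _] := hA.
have q2E : q2 = q1^-1.
  have q1_neq0 : q1 != 0 by have := Q_neq0 0; rewrite row3E.
  by apply: (mulfI q1_neq0); rewrite mulfV //; apply/esym/subr0_eq.
have [l [lam [b3 [l_neq0 lam01 b301]]]] := rescale_normal_form y_biq.
set x' := fun i => _; rewrite q2E => x'_biq.
exists x', lam, b3; split.
  (* Scaling after translating gives the constant terms [l i * m i]. *)
  split=> //; exists l, (fun i => l i * m i); split=> // i.
  by rewrite /x' scale1r scalerDr scalerA scale0r addr0.
move=> x1 x2 x3 h; split.
- exact: skew_diskew_polynomial_ring.
(* For kappa = 0 the element C is [h] and the shift is [lam]. *)
- have [iota [sigma [sigma' [iota0 iota1 sigma0 sigma1 gwa]]]] :=
    skew_classical_GWA x'_biq 0.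
  exists iota, sigma, sigma'; split=> //.
  + by rewrite iota1 scale0r addr0.
  + by rewrite sigma1 mul0r addr0.
  by move: gwa; rewrite scale0r subr0.
move=> b3_0 C.
(* This kappa annihilates the shift, so with b3 = 0 sigma fixes C. *)
have [iota [sigma [sigma' [iota0 iota1 sigma0 sigma1 gwa]]]] :=
  skew_classical_GWA x'_biq (lam * (1 - q1^-1)^-1).
have {}sigma1 : sigma 'X_1 = 'X_1.
  have q1V_neq1 : 1 - q1^-1 != 0 by rewrite -q2E subr_eq0 eq_sym.
  rewrite sigma1 b3_0 mpolyC0 addr0 -[q1^-1 - 1]opprB mulrN mulfVK // subrr.
  by rewrite scale0r addr0.
split; last by exists iota, sigma, sigma'.
have [_ _ basis_x'] := x'_biq.
have [sigmaK _ _ [[x3_iota x2_iota _ _] _]] := gwa.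
have sigma'1 : sigma' 'X_1 = 'X_1 by rewrite -[in LHS]sigma1 sigmaK.
(* It suffices to commute with generators: x_1 always does, and x_2, x_3 do because sigma' and sigma
   fix ['X_1], whose image is C. *)
apply: (pbw_span_ind basis_x') => [u v|u v|k|i].
- exact: commrD.
- exact: commrM.
- by rewrite /GRing.comm mulr_algl mulr_algr.
case: (ord3_cases i) => ->; apply: commr_sym.
- exact: (comm_x0_C x'_biq).
- by have := x2_iota 'X_1; rewrite /= sigma'1 iota1.
by have := x3_iota 'X_1; rewrite /= sigma1 iota1.
Qed.
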